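(* Let $\mathcal{N}$ be the set of all negative quadrant dependent (NQD) copulas and let $d^*_{\mathcal{N}}(x,y)=\sup_{C\in\mathcal{N}}|C(x,y)-C(y,x)|$ be its maximal asymmetry function. Then for all $x,y\in[0,1]$ $$d^*_{\mathcal{N}}(x,y)=\min\{xy,\,(1-x)(1-y),\,|x-y|\}.$$ Furthermore, for $\lambda\in\left[0,\frac12(3-\sqrt5)\right]$ put $$N_\lambda(x,y)=\max\{W(x,y),\,\min\{y-\lambda,\,xy\}\},\qquad W(x,y)=\max\{0,x+y-1\},\qquad \mu=\frac{1-3\lambda+\lambda^2}{1-\lambda}.$$ Then $N_\lambda$ is a copula, $\mu\in[0,1]$, and $$d^*_{\mathcal{N}}(x,y)=|N_\lambda(x,y)-N_\lambda(y,x)|$$ for all $x,y\in[0,1]$ with $|x+y-1|=\mu$.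
   Context: A (bivariate) copula is a function $C:[0,1]^2\to[0,1]$ such that $C(x,0)=0=C(0,y)$, $C(x,1)=x$, $C(1,y)=y$ for all $x,y\in[0,1]$, and $C(x_2,y_2)-C(x_2,y_1)-C(x_1,y_2)+C(x_1,y_1)\ge 0$ whenever $0\le x_1\le x_2\le1$ and $0\le y_1\le y_2\le 1$. A copula $C$ is negative quadrant dependent (NQD) if $C(u,v)\le uv$ for all $u,v\in[0,1]$. For a set $\mathcal{F}$ of copulas, the maximal asymmetry function is $d^*_{\mathcal{F}}(x,y)=\sup_{C\in\mathcal{F}}|C(x,y)-C(y,x)|$ for $(x,y)\in[0,1]^2$. *)

(* Defs.v *)
From mathcomp Require Import all_boot all_order all_algebra.
From mathcomp Require Import all_classical all_reals.
Set Implicit Arguments.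
Unset Strict Implicit.
Unset Printing Implicit Defensive.
Import Order.TTheory GRing.Theory Num.Theory.
Local Open Scope classical_set_scope.
Local Open Scope ring_scope.

(* Functions on the unit square are represented by total functions
   R -> R -> R of which only the values on [0,1]^2 are constrained or used. *)

Record is_copula (R : realType) (C : R -> R -> R) : Prop := IsCopula {
  copula_range : forall x y, 0 <= x <= 1 -> 0 <= y <= 1 -> 0 <= C x y <= 1;
  copula_x0 : forall x, 0 <= x <= 1 -> C x 0 = 0;
  copula_0y : forall y, 0 <= y <= 1 -> C 0 y = 0;
  copula_x1 : forall x, 0 <= x <= 1 -> C x 1 = x;
  copula_1y : forall y, 0 <= y <= 1 -> C 1 y = y;
  copula_2increasing : forall x1 x2 y1 y2,
    0 <= x1 -> x1 <= x2 -> x2 <= 1 -> 0 <= y1 -> y1 <= y2 -> y2 <= 1 ->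
    0 <= C x2 y2 - C x2 y1 - C x1 y2 + C x1 y1 }.

Definition is_nqd (R : realType) (C : R -> R -> R) : Prop :=
  forall u v, 0 <= u <= 1 -> 0 <= v <= 1 -> C u v <= u * v.

Definition nqd_copulas (R : realType) : set (R -> R -> R) :=
  [set C | is_copula C /\ is_nqd C].

(* The supremum is taken in R; for a nonempty set of copulas and x, y in [0,1]
   the set below is nonempty and bounded, so [sup] is the true supremum. *)
Definition max_asymmetry (R : realType) (F : set (R -> R -> R)) (x y : R) : R :=
  sup [set `|C x y - C y x| | C in F].

Definition copulaW (R : realType) (x y : R) : R := Num.max 0 (x + y - 1).

Definition copulaN (R : realType) (lambda x y : R) : R :=
  Num.max (copulaW x y) (Num.min (y - lambda) (x * y)).

Definition mu_of (R : realType) (lambda : R) : R :=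
  (1 - 3 * lambda + lambda ^+ 2) / (1 - lambda).

(* Main.v *)
Require Import Defs.
From mathcomp Require Import all_boot all_order all_algebra.
From mathcomp Require Import all_classical all_reals.
From mathcomp Require Import ring lra.
Import Order.TTheory GRing.Theory Num.Theory.
Local Open Scope ring_scope.

(** Upper bound: an NQD copula lies between [W] and the product, is
    nondecreasing in each variable and 1-Lipschitz in each variable.
    Attainment: the curves [|x + y - 1| = mu_of lambda] sweep out the unit
    square, so the copulas [N_lambda] already attain the bound at every point.
    That [N_lambda] is a copula follows from the flip [z = 1 - x]:
    [y - N_lambda (1 - z) y = min (min y lambda) (min z lambda)
                              + max 0 (y z - lambda)],
    a sum of two 2-increasing functions. *)

(** This mixed difference is the length of the intersection of the intervals [[a1, a2]] and
    [[b1, b2]]. *)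
Lemma min_2increasing {R : realType} {a1 a2 b1 b2 : R} :
  a1 <= a2 -> b1 <= b2 ->
  0 <= Num.min a2 b2 - Num.min a2 b1 - Num.min a1 b2 + Num.min a1 b1.
Proof.
move=> ha hb.
by case: (leP a2 b2); case: (leP a2 b1); case: (leP a1 b2); case: (leP a1 b1);
  lra.
Qed.

(** Convex nondecreasing maps such as [max 0] keep a function 2-increasing if it is nondecreasing in
    each variable. *)
Lemma max0_2increasing {R : realType} (t11 t12 t21 t22 : R) :
  t11 <= t12 -> t11 <= t21 -> t12 + t21 <= t11 + t22 ->
  0 <= Num.max 0 t22 - Num.max 0 t12 - Num.max 0 t21 + Num.max 0 t11.
Proof.
by case: (leP 0 t11); case: (leP 0 t12); case: (leP 0 t21); case: (leP 0 t22);
  lra.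
Qed.

Lemma copulaN_flip {R : realType} (l x y : R) :
  0 <= l <= 1 -> 0 <= x <= 1 -> 0 <= y <= 1 ->
  copulaN l x y =
    y - Num.min (Num.min y l) (Num.min (1 - x) l) - Num.max 0 (y * (1 - x) - l).
Proof.
move=> hl hx hy; rewrite /copulaN /copulaW.
have h1 : y * (1 - x) <= y by nra.
have h2 : y * (1 - x) <= 1 - x by nra.
have -> : x * y = y - y * (1 - x) by ring.
move: (y * (1 - x)) h1 h2 => t h1 h2.
have [lt|tl] := ltP l t.
  rewrite (min_r (_ : y - t <= y - l)); last by lra.
  rewrite (min_r (_ : l <= y)) ?(min_r (_ : l <= 1 - x)) ?minxx; try lra.
  rewrite (max_r (_ : 0 <= t - l)); last by lra.
  by rewrite max_r ?ge_max; lra.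
rewrite (min_l (_ : y - l <= y - t)); last by lra.
rewrite (max_l (_ : t - l <= 0)); last by lra.
rewrite subr0 !oppr_min !addr_maxr.
by apply/le_anti; rewrite !(le_max, ge_max); lra.
Qed.

Lemma copulaN_copula {R : realType} (l : R) :
  0 <= l <= 1 -> is_copula (copulaN l).
Proof.
move=> hl; split.
- move=> x y hx hy; rewrite /copulaN /copulaW !(le_max, ge_max, ge_min) lexx /=.
  have : x * y <= 1 by nra.
  lra.
- move=> x hx; rewrite /copulaN /copulaW mulr0.
  by apply/le_anti; rewrite !(le_max, ge_max, le_min, ge_min); lra.
- move=> y hy; rewrite /copulaN /copulaW mul0r.
  by apply/le_anti; rewrite !(le_max, ge_max, le_min, ge_min); lra.
- move=> x hx; rewrite /copulaN /copulaW mulr1.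
  by apply/le_anti; rewrite !(le_max, ge_max, le_min, ge_min); lra.
- move=> y hy; rewrite /copulaN /copulaW mul1r.
  by apply/le_anti; rewrite !(le_max, ge_max, le_min, ge_min); lra.
move=> x1 x2 y1 y2 hx1 hx hx2 hy1 hy hy2.
(* The summand [y] has zero volume; the two subtracted terms are 2-increasing in [y] and [1 - x],
   and reversing the order in [x] flips the sign of their volume. *)
rewrite !copulaN_flip; try lra.
have hm a b : a <= b -> Num.min a l <= Num.min b l.
  by move=> hab; rewrite le_min !ge_min hab lexx orbT.
have hx' : 1 - x2 <= 1 - x1 by lra.
have := min_2increasing (hm _ _ hy) (hm _ _ hx').
have := max0_2increasing (y1 * (1 - x2) - l) (y1 * (1 - x1) - l)
  (y2 * (1 - x2) - l) (y2 * (1 - x1) - l).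
move=> /(_ ltac:(nra) ltac:(nra) ltac:(nra)).
lra.
Qed.

Lemma copulaN_nqd {R : realType} (l : R) : is_nqd (copulaN l).
Proof.
move=> x y hx hy; rewrite /copulaN /copulaW !ge_max ge_min lexx orbT andbT.
by apply/andP; split; nra.
Qed.

Lemma nqd_asymmetry_le {R : realType} (C : R -> R -> R) (x y : R) :
  nqd_copulas C -> 0 <= x <= 1 -> 0 <= y <= 1 ->
  `|C x y - C y x| <=
    Num.min (x * y) (Num.min ((1 - x) * (1 - y)) `|x - y|).
Proof.
case=> -[rg x0 y0 x1 y1 inc] nqd.
wlog xy : x y / x <= y => [hw hx hy|hx hy].
  have [/hw|/ltW/hw] := leP x y; first exact.
  by rewrite distrC (mulrC y) (mulrC (1 - y)) (distrC y); apply.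
have W a b : 0 <= a <= 1 -> 0 <= b <= 1 -> a + b - 1 <= C a b.
  move=> ha hb; have := inc a 1 b 1; rewrite (x1 a) // (y1 b) // y1; lra.
(* Rectangles with a side on the boundary of the square put both [C x y] and [C y x] between [C x x]
   and [C x x + (y - x)]. *)
have nd1 : C x x <= C y x.
  have := inc x y 0 x; rewrite (x0 x) // (x0 y) //; lra.
have nd2 : C x x <= C x y.
  have := inc 0 x x y; rewrite (y0 x) // (y0 y) //; lra.
have lip1 : C y x - C x x <= y - x.
  have := inc x y x 1; rewrite (x1 x) // (x1 y) //; lra.
have lip2 : C x y - C x x <= y - x.
  have := inc x 1 x y; rewrite (y1 x) // (y1 y) //; lra.
have rg1 := rg x y hx hy; have rg2 := rg y x hy hx.
have W1 := W x y hx hy; have W2 := W y x hy hx.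
have q1 := nqd x y hx hy; have q2 := nqd y x hy hx.
rewrite !le_min !ler_norml (ler0_norm (_ : x - y <= 0)); last by lra.
(* This is the gap between the product and the lower bound [x + y - 1]. *)
have -> : (1 - x) * (1 - y) = x * y - (x + y - 1) by ring.
rewrite (mulrC y) in q2.
lra.
Qed.

(** The form of [copulaN] on the triangle where [W] vanishes. *)
Definition truncN {R : realType} (l x y : R) : R :=
  Num.max 0 (Num.min (y - l) (x * y)).

(** The last hypothesis is [x + y = 1 - mu_of l] with the denominator cleared. *)
Lemma truncN_asymmetry {R : realType} (l x y : R) :
  0 <= l < 1 -> 0 <= x <= 1 -> 0 <= y <= 1 ->
  (x + y) * (1 - l) = l * (2 - l) ->
  `|truncN l x y - truncN l y x| = Num.min (x * y) `|x - y|.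
Proof.
move=> hl.
wlog xy : x y / x <= y => [hw hx hy hs|hx hy hs].
  have [/hw|/ltW/hw] := leP x y; first exact.
  rewrite distrC (mulrC y) (distrC y); apply => //; lra.
(* Hence [min (y - l) (x * y)] switches branch at [x = l]: the two values are [x * y] and [0] before
   it, [y - l] and [x - l] after it. *)
have key : (1 - l) * (y * (1 - x) - l) = (l - x) * (1 - x + l * x).
  have -> : (1 - l) * (y * (1 - x) - l) =
    (1 - x) * ((x + y) * (1 - l)) - (1 - l) * (x * (1 - x) + l) by ring.
  by rewrite hs; ring.
have t0 : 0 <= x * y by nra.
rewrite (ler0_norm (_ : x - y <= 0)); last by lra.
rewrite /truncN (mulrC y x).
have [xl|lx] := leP x l.
  have hp : l <= y - x * y.
    suff : 0 <= (1 - l) * (y * (1 - x) - l) by rewrite pmulr_rge0; lra.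
    by rewrite key mulr_ge0 //; nra.
  rewrite (min_r (_ : x * y <= y - l)); last by lra.
  rewrite (max_r (_ : 0 <= x * y)) //.
  rewrite (max_l (_ : _ <= 0)); last by rewrite ge_min; lra.
  by rewrite subr0 ger0_norm // min_l //; lra.
have hp : y - x * y <= l.
  suff : (1 - l) * (y * (1 - x) - l) <= 0 by rewrite pmulr_rle0; lra.
  by rewrite key mulr_le0_ge0 //; nra.
rewrite (min_l (_ : y - l <= x * y)) ?(min_l (_ : x - l <= x * y)); try lra.
rewrite min_r; last by lra.
by rewrite !max_r ?ger0_norm; lra.
Qed.

Lemma copulaN_truncN {R : realType} (l x y : R) :
  x + y <= 1 -> copulaN l x y = truncN l x y.
Proof.
by move=> h; rewrite /copulaN /copulaW (max_l (_ : x + y - 1 <= 0)) //; lra.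
Qed.

(* The reflection [(x, y) -> (1 - y, 1 - x)] exchanges the two lines
   [x + y - 1 = +/- mu]. *)
Lemma copulaN_truncN_reflect {R : realType} (l x y : R) :
  1 <= x + y -> copulaN l x y = x + y - 1 + truncN l (1 - y) (1 - x).
Proof.
move=> h; rewrite /copulaN /copulaW /truncN.
rewrite (max_r (_ : 0 <= x + y - 1)); last by lra.
rewrite addr_maxr addr_minr addr0.
by congr (Num.max _ (Num.min _ _)); ring.
Qed.

Lemma copulaN_asymmetry {R : realType} (l x y : R) :
  0 <= l < 1 -> 0 <= x <= 1 -> 0 <= y <= 1 -> `|x + y - 1| = mu_of l ->
  `|copulaN l x y - copulaN l y x| =
    Num.min (x * y) (Num.min ((1 - x) * (1 - y)) `|x - y|).
Proof.
move=> hl hx hy hmu.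
have {}hmu : `|x + y - 1| * (1 - l) = 1 - 3 * l + l ^+ 2.
  by rewrite hmu /mu_of divfK //; lra.
(* As [(1 - x) * (1 - y) - x * y = 1 - (x + y)], the side of the antidiagonal decides which product
   is smaller. *)
have [h|/ltW h] := leP (x + y) 1.
  move: hmu; rewrite ler0_norm; last by lra.
  move=> hmu; rewrite !copulaN_truncN; try lra.
  rewrite truncN_asymmetry //; last by nra.
  by rewrite minA (min_l (_ : x * y <= (1 - x) * (1 - y))) //; nra.
move: hmu; rewrite ger0_norm; last by lra.
move=> hmu; rewrite !copulaN_truncN_reflect; try lra.
rewrite (_ : _ - _ = truncN l (1 - y) (1 - x) - truncN l (1 - x) (1 - y));
  last by ring.
rewrite truncN_asymmetry; try nra.
have -> : 1 - y - (1 - x) = x - y by ring.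
by rewrite minA (mulrC (1 - y)) (min_r (_ : _ <= x * y)) //; nra.
Qed.

Lemma max_asymmetry_nqd {R : realType} {l x y : R} :
  0 <= l < 1 -> 0 <= x <= 1 -> 0 <= y <= 1 -> `|x + y - 1| = mu_of l ->
  max_asymmetry (@nqd_copulas R) x y =
    Num.min (x * y) (Num.min ((1 - x) * (1 - y)) `|x - y|).
Proof.
move=> hl hx hy hmu; rewrite /max_asymmetry.
set S := image _ _; set m := Num.min _ _.
have Sm : S m.
  exists (copulaN l); last exact: copulaN_asymmetry.
  by split; [apply: copulaN_copula; lra | exact: copulaN_nqd].
have ubm : ubound S m by move=> _ [C CF <-]; exact: nqd_asymmetry_le.
apply/le_anti/andP; split; first by apply: ge_sup => //; exists m.
by apply: ub_le_sup => //; exists m.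
Qed.

(* [lambda] is the smaller root of
   [lambda ^ 2 - (3 - m) lambda + (1 - m) = 0]. *)
Lemma mu_of_surj {R : realType} {m : R} :
  0 <= m <= 1 -> exists2 l : R, 0 <= l < 1 & mu_of l = m.
Proof.
(* The radicand is the discriminant [(3 - m) ^ 2 - 4 (1 - m)]. *)
move=> hm; pose s := Num.sqrt ((1 - m) ^+ 2 + 4).
have s2 : s ^+ 2 = (1 - m) ^+ 2 + 4 by rewrite sqr_sqrtr //; nra.
have s0 : 0 <= s by exact: sqrtr_ge0.
have sl : 1 - m < s by nra.
have su : s <= 3 - m by nra.
exists ((3 - m - s) / 2); first lra.
have d0 : 1 - (3 - m - s) / 2 != 0 by lra.
by apply: (canLR (mulfK d0)); nra.
Qed.

(** The upper end of the range is the smaller root of [1 - 3 l + l ^ 2], the numerator of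
    [mu_of l]. *)
Lemma lambda_range {R : realType} {l : R} :
  0 <= l <= 1 / 2 * (3 - Num.sqrt 5) -> 0 <= l < 1 /\ 0 <= 1 - 3 * l + l ^+ 2.
Proof.
have s2 : Num.sqrt (5 : R) ^+ 2 = 5 by rewrite sqr_sqrtr //; lra.
have : 0 <= Num.sqrt (5 : R) by exact: sqrtr_ge0.
move: (Num.sqrt _) s2 => s s2 s0 hl.
have s1 : 1 < s by nra.
by split; nra.
Qed.

Theorem theorem3p2 (R : realType) :
  (forall x y : R, 0 <= x <= 1 -> 0 <= y <= 1 ->
     max_asymmetry (@nqd_copulas R) x y =
       Num.min (x * y) (Num.min ((1 - x) * (1 - y)) `|x - y|)) /\
  (forall lambda : R, 0 <= lambda <= 1 / 2 * (3 - Num.sqrt 5) ->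
     [/\ is_copula (copulaN lambda),
         0 <= mu_of lambda <= 1
       & forall x y : R, 0 <= x <= 1 -> 0 <= y <= 1 ->
           `|x + y - 1| = mu_of lambda ->
           max_asymmetry (@nqd_copulas R) x y =
             `|copulaN lambda x y - copulaN lambda y x| ]).
Proof.
split=> [x y hx hy|l /lambda_range[hl hq]].
  have hm : 0 <= `|x + y - 1| <= 1 by rewrite normr_ge0 ler_norml /=; lra.
  have [l hl hmu] := mu_of_surj hm.
  exact: (max_asymmetry_nqd hl).
split.
- by apply: copulaN_copula; lra.
- have l1 : 0 < 1 - l by lra.
  by rewrite /mu_of divr_ge0 ?(ltW l1) //= ler_pdivrMr // mul1r; nra.
- move=> x y hx hy hmu.
  by rewrite copulaN_asymmetry // (max_asymmetry_nqd hl).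
Qed.
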